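(* Let $X_1,\dots,X_n$ be Banach spaces, $I$ an arbitrary index set, and let $(\varphi_\alpha)_{\alpha\in I}$ be an admissible family of mappings from $X_1\times\cdots\times X_n$ into $[0,\infty)$. Then the following assertions are equivalent: (1) For every $M>0$, there exist $\alpha\in I$ and $(x_1,\dots,x_n)\in X_1\times\cdots\times X_n$ with $\|(x_1,\dots,x_n)\|=1$ such that $\varphi_\alpha(x_1,\dots,x_n)>M$. (2) There exists a vector $(x_1,\dots,x_n)\in X_1\times\cdots\times X_n$ such that $\sup_{\alpha\in I}\varphi_\alpha(x_1,\dots,x_n)=\infty$. (3) The set of all vectors $(x_1,\dots,x_n)\in X_1\times\cdots\times X_n$ such that $\sup_{\alpha\in I}\varphi_\alpha(x_1,\dots,x_n)=\infty$ is a dense $G_\delta$-subset of $X_1\times\cdots\times X_n$.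
   Context: The product $X_1\times\cdots\times X_n$ carries the norm $\|(x_1,\dots,x_n)\|=\max_{1\le i\le n}\|x_i\|_{X_i}$. A family $(\varphi_\alpha)_{\alpha\in I}$ of mappings from $X_1\times\cdots\times X_n$ into $[0,\infty)$ is admissible if: (i) each $\varphi_\alpha$ is lower semicontinuous; (ii) there is $r>0$ such that $\varphi_\alpha(\lambda x)=\lambda^r\varphi_\alpha(x)$ for all $\lambda\ge0$, all $x\in X_1\times\cdots\times X_n$ and all $\alpha\in I$; (iii) there is $C>0$ such that for all $(x_1,\dots,x_n),(y_1,\dots,y_n)\in X_1\times\cdots\times X_n$ and all $\alpha\in I$, $\varphi_\alpha(x_1-y_1,\dots,x_n-y_n)\le C\max_{z_i\in\{x_i,y_i\}}\varphi_\alpha(z_1,\dots,z_n)$, the maximum being over all $2^n$ choices $z_i\in\{x_i,y_i\}$. *)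

(* Defs.v *)
From HB Require Import structures.
From mathcomp Require Import all_boot all_order all_algebra.
From mathcomp Require Import all_classical all_reals all_analysis.

Set Implicit Arguments.
Unset Strict Implicit.
Unset Printing Implicit Defensive.

Import Order.TTheory GRing.Theory Num.Theory.
Import numFieldNormedType.Exports.

Local Open Scope classical_set_scope.
Local Open Scope ring_scope.

(* The product X_0 x ... x X_(n-1) as a Banach space: coordinatewise operations
   and the max norm, from which the topology is derived.  The scalars are real;
   complex Banach spaces are included by restriction of scalars. *)
Definition banach_prod (R : realType) (n : nat)
  (X : 'I_n -> completeNormedModType R) := forall i, X i.

Section banach_prod_normed.
Context {R : realType} {n : nat} (X : 'I_n -> completeNormedModType R).
Local Notation T := (banach_prod X).
Implicit Types x y z : T.

HB.instance Definition _ := gen_eqMixin T.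
HB.instance Definition _ := gen_choiceMixin T.

Definition prod_zero : T := fun=> 0.
Definition prod_opp x : T := fun i => - x i.
Definition prod_add x y : T := fun i => x i + y i.
Definition prod_scale (a : R) x : T := fun i => a *: x i.

Let prod_addA : associative prod_add.
Proof. by move=> x y z; apply: functional_extensionality_dep => i; exact: addrA. Qed.
Let prod_addC : commutative prod_add.
Proof. by move=> x y; apply: functional_extensionality_dep => i; exact: addrC. Qed.
Let prod_add0 : left_id prod_zero prod_add.
Proof. by move=> x; apply: functional_extensionality_dep => i; exact: add0r. Qed.
Let prod_addN : left_inverse prod_zero prod_opp prod_add.
Proof. by move=> x; apply: functional_extensionality_dep => i; exact: addNr. Qed.

HB.instance Definition _ :=
  GRing.isZmodule.Build T prod_addA prod_addC prod_add0 prod_addN.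

Let prod_scaleA a b x : prod_scale a (prod_scale b x) = prod_scale (a * b) x.
Proof. by apply: functional_extensionality_dep => i; exact: scalerA. Qed.
Let prod_scale1 : left_id 1 prod_scale.
Proof. by move=> x; apply: functional_extensionality_dep => i; exact: scale1r. Qed.
Let prod_scaleDr : right_distributive prod_scale +%R.
Proof. by move=> a x y; apply: functional_extensionality_dep => i; exact: scalerDr. Qed.
Let prod_scaleDl x : {morph prod_scale^~ x : a b / a + b}.
Proof. by move=> a b; apply: functional_extensionality_dep => i; exact: scalerDl. Qed.

HB.instance Definition _ := GRing.Zmodule_isLmodule.Build R T
  prod_scaleA prod_scale1 prod_scaleDr prod_scaleDl.

Definition prod_norm x : R := \big[Num.max/0]_(i < n) `|x i|.

Let le_prod_norm x i : `|x i| <= prod_norm x.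
Proof. by apply/bigmax_geP; right; exists i. Qed.

Let prod_norm_ge0 x : 0 <= prod_norm x.
Proof. by apply/bigmax_geP; left. Qed.

Let ler_prod_normD x y : prod_norm (x + y) <= prod_norm x + prod_norm y.
Proof.
apply/bigmax_leP; split=> [|i _]; first by rewrite addr_ge0.
apply: le_trans (ler_normD _ _) _.
by rewrite lerD ?le_prod_norm.
Qed.

Let prod_normZ a x : prod_norm (a *: x) = `|a| * prod_norm x.
Proof.
rewrite /prod_norm (eq_bigr (fun i => `|a| * `|x i|)); last first.
  by move=> i _; exact: normrZ.
elim/big_ind2 : _ => // [|b c d e -> ->]; first by rewrite mulr0.
by rewrite maxr_pMr.
Qed.

Let prod_norm_eq0 x : prod_norm x = 0 -> x = 0.
Proof.
move=> x0; apply: functional_extensionality_dep => i; apply/eqP.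
by rewrite -normr_le0 -[leRHS]x0 le_prod_norm.
Qed.

HB.instance Definition _ :=
  Lmodule_isNormed.Build R T ler_prod_normD prod_normZ prod_norm_eq0.

Lemma banach_prod_normE x : `|x| = \big[Num.max/0]_(i < n) `|x i|.
Proof. by []. Qed.

Lemma banach_prod_ballP x (e : R) y : 0 < e ->
  ball x e y <-> forall i, ball (x i) e (y i).
Proof.
move=> e0; rewrite -ball_normE /= banach_prod_normE; split.
- move=> /bigmax_ltP[_ xy] i; rewrite -ball_normE/=; exact: xy.
- move=> xy; apply/bigmax_ltP; split=> // i _.
  by have := xy i; rewrite -ball_normE.
Qed.

Let banach_prod_complete (F : set_system T) :
  ProperFilter F -> cauchy F -> cvg F.
Proof.
move=> FF Fc.
have Fi i : cvg ((fun x : T => x i) @ F).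
  apply: cauchy_cvg; apply: cauchy_exP => e e0.
  have [x Fx] := (cauchyP F).1 Fc e e0; exists (x i).
  suff : \forall y \near F, ball (x i) e (y i) by [].
  by apply: filterS Fx => y xy; move: i; apply/banach_prod_ballP.
pose l : T := fun i => lim ((fun x : T => x i) @ F).
apply/cvg_ex; exists l; apply/cvg_ballP => e e0.
have : \forall x \near F, forall i, ball (l i) e (x i).
  by apply: filter_forall => i; exact: (cvg_ball (Fi i)).
by apply: filterS => x xl; exact/banach_prod_ballP.
Qed.

HB.instance Definition _ := Uniform_isComplete.Build T banach_prod_complete.

End banach_prod_normed.

Section admissible.
Context {R : realType} {n : nat} (X : 'I_n -> completeNormedModType R).
Local Notation T := (banach_prod X).

(* [mix s x y] is the choice z_i \in {x_i, y_i} coded by s. *)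
Definition mix (s : {ffun 'I_n -> bool}) (x y : T) : T :=
  fun i => if s i then x i else y i.

(* The iterated maximum is over nonnegative values, so its initial value 0 is
   immaterial. *)
Definition admissible (I : Type) (phi : I -> T -> R) : Prop :=
  [/\ forall alpha x, 0 <= phi alpha x,
      forall alpha, lower_semicontinuous (EFin \o phi alpha),
      exists2 r : R, 0 < r &
        forall (lambda : R) (x : T) (alpha : I), 0 <= lambda ->
          phi alpha (lambda *: x) = lambda `^ r * phi alpha x &
      exists2 C : R, 0 < C &
        forall (x y : T) (alpha : I),
          phi alpha (x - y) <=
          C * \big[Num.max/0]_(s : {ffun 'I_n -> bool}) phi alpha (mix s x y)].

Definition family_sup (I : Type) (phi : I -> T -> R) (x : T) : \bar R :=
  ereal_sup (range (fun alpha => (phi alpha x)%:E)).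

End admissible.

(* Main.v *)
(* Let U_k be the set of x with sup_alpha phi_alpha x > k; it is open by lower
   semicontinuity, and the intersection of the U_k is the set where the supremum
   is infinite.  If some U_k missed a ball around a, then for |x| = 1 and e small
   every mixture of a + e x and a would lie in that ball, so the difference
   condition applied to e x = (a + e x) - a and homogeneity would bound the
   family uniformly on the unit sphere.  Hence (1) makes every U_k dense, and
   Baire's theorem gives (3). *)
Require Import Defs.
From mathcomp Require Import all_boot all_order all_algebra.
From mathcomp Require Import all_classical all_reals all_analysis.
From mathcomp Require Import borel_hierarchy.

Import Order.TTheory GRing.Theory Num.Theory.
Import numFieldNormedType.Exports.

Local Open Scope classical_set_scope.
Local Open Scope ring_scope.

Section uniform_boundedness.
Context {R : realType} {n : nat} {X : 'I_n -> completeNormedModType R}.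
Context {I : Type} (phi : I -> banach_prod X -> R).
Implicit Types x y a : banach_prod X.

(** For the max norm a ball is a product of coordinate balls, so exchanging coordinates between two
    of its points does not leave it. *)
Lemma ball_mix (s : {ffun 'I_n -> bool}) a x y (e : R) : 0 < e ->
  ball a e x -> ball a e y -> ball a e (mix s x y).
Proof.
move=> e0 /(banach_prod_ballP _ _ e0) ax /(banach_prod_ballP _ _ e0) ay.
by apply/(banach_prod_ballP _ _ e0) => i; rewrite /mix; case: ifP.
Qed.

Lemma lt_family_supP (M : R) x :
  (M%:E < family_sup phi x)%E <-> exists alpha, M < phi alpha x.
Proof.
split=> [/ereal_sup_gt[_ [alpha _ <-]]|[alpha Mphi]].
  by rewrite lte_fin; exists alpha.
have : ((phi alpha x)%:E <= family_sup phi x)%E.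
  by apply: ereal_sup_ubound; exists alpha.
by apply: lt_le_trans; rewrite lte_fin.
Qed.

Lemma family_sup_pinftyP x :
  family_sup phi x = +oo%E <-> forall M : R, exists alpha, M < phi alpha x.
Proof.
split=> [supx M|unbounded]; first by apply/lt_family_supP; rewrite supx ltry.
by apply: eq_infty => M; apply/ltW/lt_family_supP.
Qed.

Lemma family_sup_pinfty_bigcap :
  [set x | family_sup phi x = +oo%E] =
  \bigcap_k [set x | (k%:R%:E < family_sup phi x)%E].
Proof.
apply/seteqP; split=> [x supx k _|x xU]; first by rewrite /= supx ltry.
apply/family_sup_pinftyP => M; apply/lt_family_supP.
(* This index is a natural number above [|M|], hence above [M]. *)
have := xU (Num.truncn `|M|).+1 Logic.I; apply: le_lt_trans; rewrite lee_fin.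
by rewrite (le_trans (ler_norm M))// ltW// truncnS_gt.
Qed.

Hypothesis phi_adm : admissible phi.

Lemma open_lt_family_sup (M : R) : open [set x | (M%:E < family_sup phi x)%E].
Proof.
case: phi_adm => _ phi_lsc _ _.
rewrite [X in open X](_ : _ = \bigcup_alpha [set x | (M%:E < (phi alpha x)%:E)%E]).
  by apply: bigcup_open => alpha _; move/lower_semicontinuousP: (phi_lsc alpha); exact.
apply/seteqP; split=> x.
  by move=> /lt_family_supP[alpha Mphi]; exists alpha => //=; rewrite lte_fin.
by case=> alpha _ /=; rewrite lte_fin => Mphi; apply/lt_family_supP; exists alpha.
Qed.

Lemma bounded_ball_bounded_sphere a (e k : R) : 0 < e ->
  (forall alpha y, ball a e y -> phi alpha y <= k) ->
  exists M : R, forall alpha x, `|x| = 1 -> phi alpha x <= M.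
Proof.
case: phi_adm => phi_ge0 _ [r r0 phiZ] [C C0 phiB] e0 phik.
have e20 : 0 < e / 2 by rewrite divr_gt0.
(* The bound comes from [(e / 2) ^ r * phi alpha x = phi alpha ((e / 2) *: x) <= C * k]; halving [e]
   keeps [a + (e / 2) *: x] inside the open ball. *)
exists (C * k / (e / 2) `^ r) => alpha x x1.
rewrite ler_pdivlMr ?powR_gt0// mulrC -(phiZ _ _ _ (ltW e20)).
have -> : (e / 2) *: x = (a + (e / 2) *: x) - a by rewrite addrC addKr.
apply: le_trans (phiB _ _ _) _; rewrite ler_pM2l//.
have aa : ball a e a by exact: ballxx.
(* The initial value 0 of the maximum requires [0 <= k], which is read off at the centre [a]. *)
apply/bigmax_leP; split=> [|s _]; first exact: le_trans (phi_ge0 alpha a) (phik _ _ aa).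
apply/phik/ball_mix => //.
rewrite -ball_normE/= opprD addNKr normrN normrZ x1 mulr1 gtr0_norm//.
by rewrite ltr_pdivrMr// ltr_pMr// ltr1n.
Qed.

Definition unbounded_on_sphere :=
  forall M : R, 0 < M -> exists alpha x, `|x| = 1 /\ M < phi alpha x.

Lemma dense_lt_family_sup (M : R) : unbounded_on_sphere ->
  dense [set x | (M%:E < family_sup phi x)%E].
Proof.
move=> unbd; apply: contrapT => /denseNE[U [[a aU] U0]].
have /nbhs_ballP[e /= e0 aeU] : nbhs a U by exact: open_nbhs_nbhs.
have [alpha y aey|B phiB] := @bounded_ball_bounded_sphere a e M e0.
  (* The ball lies in [U], which misses the superlevel set, so [M] bounds the whole family there. *)
  rewrite leNgt; apply/negP => Mphi.
  suff : (U `&` [set x | (M%:E < family_sup phi x)%E]) y by rewrite U0.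
  by split; [exact: aeU|apply/lt_family_supP; exists alpha].
(* The threshold has to be positive, whereas the sign of [B] is unknown. *)
have [|alpha [x [x1]]] := unbd (`|B| + 1); first by rewrite ltr_wpDl.
apply/negP; rewrite -leNgt (le_trans (phiB _ _ x1))//.
by rewrite (le_trans (ler_norm B))// lerDl.
Qed.

Lemma family_sup_pinfty_unbounded_on_sphere x :
  family_sup phi x = +oo%E -> unbounded_on_sphere.
Proof.
case: phi_adm => phi_ge0 _ [r r0 phiZ] _ /family_sup_pinftyP supx M M0.
(* Homogeneity with factor 0 and [r > 0] makes every [phi alpha] vanish at the origin, so [x] is
   nonzero and can be normalized. *)
have x0 : 0 < `|x|.
  rewrite normr_gt0; apply/eqP => x0; have [alpha] := supx 0.
  by rewrite x0 -(scale0r (0 : banach_prod X)) phiZ// powR0 ?gt_eqF// mul0r ltxx.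
have phix alpha : phi alpha x = `|x| `^ r * phi alpha (`|x|^-1 *: x).
  by rewrite -phiZ// scalerA divff ?scale1r ?gt_eqF.
(* The factor [|x| ^ r] is what normalizing [x] divides out. *)
have [alpha] := supx (`|x| `^ r * M).
rewrite phix ltr_pM2l ?powR_gt0// => Mphi.
exists alpha, (`|x|^-1 *: x); split=> //.
by rewrite normrZ ger0_norm ?invr_ge0// mulVf// gt_eqF.
Qed.

End uniform_boundedness.

Theorem theorem5p3 (R : realType) (n : nat) (n_gt0 : (0 < n)%N)
    (X : 'I_n -> completeNormedModType R) (I : Type)
    (phi : I -> banach_prod X -> R) (phi_adm : admissible phi) :
  [<-> forall M : R, 0 < M ->
         exists (alpha : I) (x : banach_prod X),
           `|x| = 1 /\ M < phi alpha x;
       exists x : banach_prod X, family_sup phi x = +oo%E;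
       dense [set x : banach_prod X | family_sup phi x = +oo%E] /\
       Gdelta [set x : banach_prod X | family_sup phi x = +oo%E]].
Proof.
have dense_Gdelta : unbounded_on_sphere phi ->
    dense [set x : banach_prod X | family_sup phi x = +oo%E] /\
    Gdelta [set x : banach_prod X | family_sup phi x = +oo%E].
  move=> unbd; rewrite family_sup_pinfty_bigcap; split.
    by apply: Baire => k; split; [exact: open_lt_family_sup|exact: dense_lt_family_sup].
  by eexists; [|reflexivity] => k; exact: open_lt_family_sup.
have dense_ex : dense [set x : banach_prod X | family_sup phi x = +oo%E] ->
    exists x : banach_prod X, family_sup phi x = +oo%E.
  (* A dense set meets the whole space, which is nonempty as it contains 0. *)
  by move=> /(_ setT)[||x [_ supx]]; [exists 0|exact: openT|exists x].
tfae.
- by move=> /dense_Gdelta[/dense_ex].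
- by move=> [x /(family_sup_pinfty_unbounded_on_sphere _ phi_adm)/dense_Gdelta].
- move=> [/dense_ex[x supx] _].
  exact: family_sup_pinfty_unbounded_on_sphere supx.
Qed.
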